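(* For any positive integer $m$ and any real $a > 0$, $$\sum_{n=0}^{\infty}\frac{L_{2^{n+1}m}^{a}-1}{F_{2^{n+2}m}^{a}} = \frac{1}{F_m^{a}L_m^{a}}.$$
   Context: $F_n$ and $L_n$ denote the $n$-th Fibonacci and Lucas numbers: $F_n = \frac{\alpha^n-\beta^n}{\sqrt5}$ and $L_n=\alpha^n+\beta^n$, where $\alpha=\frac{1+\sqrt5}{2}$ and $\beta=\frac{1-\sqrt5}{2}$ (so $F_0=0$, $F_1=1$, $L_0=2$, $L_1=1$). $F_k^a$ and $L_k^a$ denote the $a$-th powers $(F_k)^a$ and $(L_k)^a$. *)

(* Defs.v *)
(* Stdlib reals with Coquelicot. *)
From Stdlib Require Import Reals.
From Coquelicot Require Import Coquelicot.

Open Scope R_scope.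

Definition alpha : R := (1 + sqrt 5) / 2.
Definition beta : R := (1 - sqrt 5) / 2.

Definition fib (n : nat) : R := (alpha ^ n - beta ^ n) / sqrt 5.
Definition lucas (n : nat) : R := alpha ^ n + beta ^ n.

(* Main.v *)
Require Import Defs.
From Stdlib Require Import Reals Lra Lia.
From Coquelicot Require Import Coquelicot.

Open Scope R_scope.

(** Since [F_{2k} = F_k L_k], the [n]-th term with [k = 2^(n+1) m] equals
    [1/F_k^a - 1/F_{2k}^a]: the series telescopes to [1/F_{2m}^a], because
    [F_{2^n m}] tends to infinity. *)

(** With [x] = F_k^a and [y] = L_k^a, the doubling formula [fib_double] gives (y - 1)/(x y) = 1/x -
    1/(x y), which is the telescoping identity. The surviving term 1/F_{2m}^a is the claimed sum, by
    doubling once more. Growth and positivity of [fib] both come from [alpha > 1] and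
    [|beta| < 1]. *)

Lemma sqrt5_bounds : 2 < sqrt 5 < 3.
Proof.
  assert (Hs : sqrt 5 * sqrt 5 = 5) by (apply sqrt_sqrt; lra).
  assert (H0 : 0 <= sqrt 5) by apply sqrt_pos.
  split; nra.
Qed.

Lemma alpha_gt_1 : 1 < alpha.
Proof. unfold alpha; pose proof sqrt5_bounds; lra. Qed.

Lemma Rabs_beta_lt_1 : Rabs beta < 1.
Proof. unfold beta; pose proof sqrt5_bounds; apply Rabs_def1; lra. Qed.

Lemma Rabs_beta_pow_le_1 (n : nat) : Rabs (beta ^ n) <= 1.
Proof.
  rewrite <- RPow_abs, <- (pow1 n).
  apply pow_incr; split; [apply Rabs_pos | apply Rlt_le, Rabs_beta_lt_1].
Qed.

(** Powers of [beta] never exceed 1 in absolute value. This single bound yields both positivity and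
    divergence. *)
Lemma fib_lower_bound (n : nat) : (alpha ^ n - 1) / sqrt 5 <= fib n.
Proof.
  unfold fib, Rdiv; pose proof sqrt5_bounds.
  apply Rmult_le_compat_r.
  - apply Rlt_le, Rinv_0_lt_compat; lra.
  - destruct (Rabs_le_between (beta ^ n) 1) as [Hb _].
    specialize (Hb (Rabs_beta_pow_le_1 n)); lra.
Qed.

Lemma fib_pos (n : nat) : (0 < n)%nat -> 0 < fib n.
Proof.
  intros Hn; pose proof sqrt5_bounds.
  apply Rlt_le_trans with (2 := fib_lower_bound n).
  apply Rdiv_lt_0_compat; [| lra].
  pose proof (Rlt_pow_R1 alpha n alpha_gt_1 Hn); lra.
Qed.

Lemma lucas_pos (n : nat) : (0 < n)%nat -> 0 < lucas n.
Proof.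
  intros Hn; unfold lucas.
  pose proof (Rlt_pow_R1 alpha n alpha_gt_1 Hn).
  destruct (Rabs_le_between (beta ^ n) 1) as [Hb _].
  specialize (Hb (Rabs_beta_pow_le_1 n)); lra.
Qed.

Lemma fib_double (n : nat) : fib (2 * n) = fib n * lucas n.
Proof.
  unfold fib, lucas; pose proof sqrt5_bounds.
  replace (2 * n)%nat with (n + n)%nat by lia.
  rewrite !pow_add; field; lra.
Qed.

Lemma is_lim_seq_fib : is_lim_seq fib p_infty.
Proof.
  pose proof sqrt5_bounds.
  apply (is_lim_seq_le_p_loc (fun n => (alpha ^ n - 1) / sqrt 5)).
  - exists 0%nat; intros n _; apply fib_lower_bound.
  - apply (is_lim_seq_div _ _ p_infty (sqrt 5)).
    + apply (is_lim_seq_minus _ _ p_infty 1).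
      * apply is_lim_seq_geom_p, alpha_gt_1.
      * apply is_lim_seq_const.
      * reflexivity.
    + apply is_lim_seq_const.
    + intros E; injection E; lra.
    + apply is_Rbar_mult_p_infty_pos; simpl; apply Rinv_0_lt_compat; lra.
Qed.

(** [Rpower x a] is [exp (a * ln x)], and [a > 0] keeps the exponent tending to plus infinity. *)
Lemma is_lim_seq_inv_Rpower (u : nat -> R) (a : R) :
  0 < a -> is_lim_seq u p_infty ->
  is_lim_seq (fun n => / Rpower (u n) a) 0.
Proof.
  intros Ha Hu.
  apply (is_lim_seq_inv _ p_infty); [| easy].
  unfold Rpower.
  apply (filterlim_comp _ _ _ (fun n => a * ln (u n)) exp
           eventually (Rbar_locally p_infty)); [| apply is_lim_exp_p].
  apply (is_lim_seq_mult (fun _ => a) (fun n => ln (u n)) a p_infty).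
  - apply is_lim_seq_const.
  - apply (filterlim_comp _ _ _ u ln eventually (Rbar_locally p_infty));
      [exact Hu | apply is_lim_ln_p].
  - apply is_Rbar_mult_sym, is_Rbar_mult_p_infty_pos; exact Ha.
Qed.

(** The partial sum up to [n] collapses to [u 0 - u (S n)]. *)
Lemma is_series_telescope (u : nat -> R) :
  is_lim_seq u 0 -> is_series (fun n => u n - u (S n)) (u 0%nat).
Proof.
  intros Hu.
  change (is_lim_seq (sum_n (fun n => u n - u (S n))) (u 0%nat)).
  apply (is_lim_seq_ext (fun n => u 0%nat - u (S n))).
  - intros n; induction n as [| n IH].
    + now rewrite sum_O.
    + rewrite sum_Sn, <- IH; unfold plus; simpl; ring.
  - replace (u 0%nat) with (u 0%nat - 0) at 1 by ring.
    apply is_lim_seq_minus'; [apply is_lim_seq_const |].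
    now apply (is_lim_seq_incr_1 u).
Qed.

Theorem theorem2 (m : nat) (a : R) (hm : (0 < m)%nat) (ha : 0 < a) :
  is_series
    (fun n : nat =>
       (Rpower (lucas (2 ^ (n + 1) * m)) a - 1)
         / Rpower (fib (2 ^ (n + 2) * m)) a)
    (1 / (Rpower (fib m) a * Rpower (lucas m) a)).
Proof.
  set (u := fun n : nat => / Rpower (fib (2 ^ (n + 1) * m)) a).
  (* Taken at [n + 1], this makes the indices positive, hence also strictly increasing under
     doubling. *)
  assert (Hk : forall n, (n < 2 ^ n * m)%nat).
  { intros n; pose proof (Nat.pow_gt_lin_r 2 n); nia. }
  replace (1 / (Rpower (fib m) a * Rpower (lucas m) a)) with (u 0%nat).
  - apply (is_series_ext (fun n => u n - u (S n))).
    + intros n; unfold u.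
      replace (2 ^ (S n + 1) * m)%nat with (2 * (2 ^ (n + 1) * m))%nat
        by (rewrite Nat.add_succ_l, Nat.pow_succ_r'; lia).
      replace (2 ^ (n + 2) * m)%nat with (2 * (2 ^ (n + 1) * m))%nat
        by (rewrite !Nat.pow_add_r; simpl; lia).
      assert (Hp : (0 < 2 ^ (n + 1) * m)%nat) by (specialize (Hk (n + 1)%nat); lia).
      (* [Rpower] is multiplicative on positive bases, whence the positivity lemmas. *)
      rewrite fib_double, <- Rpower_mult_distr by
        first [now apply fib_pos | now apply lucas_pos].
      (* [is_series_ext] states the equality in the carrier of a normed module; [field] needs it in
         [R]. *)
      match goal with |- ?x = ?y => change (@eq R x y) end.
      field; split; apply Rgt_not_eq, exp_pos.
    + apply is_series_telescope.
      apply (is_lim_seq_inv_Rpower (fun n => fib (2 ^ (n + 1) * m)) a ha).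
      apply (is_lim_seq_subseq fib p_infty (fun n => (2 ^ (n + 1) * m)%nat));
        [| exact is_lim_seq_fib].
      apply eventually_subseq.
      intros n; rewrite Nat.add_succ_l, Nat.pow_succ_r'.
      specialize (Hk (n + 1)%nat); lia.
  - unfold u.
    replace (2 ^ (0 + 1) * m)%nat with (2 * m)%nat by (simpl; lia).
    rewrite fib_double, <- Rpower_mult_distr
      by first [now apply fib_pos | now apply lucas_pos].
    unfold Rdiv; ring.
Qed.
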